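(* Let $R$ be a commutative integral domain such that every singular $2\times 2$ matrix with entries in $R$ is a product of idempotent matrices (with entries in $R$). Then every invertible $2\times 2$ matrix with entries in $R$ is a product of elementary matrices (with entries in $R$).
   Context: A matrix over an integral domain is singular if its determinant is $0$. A square matrix $E$ is idempotent if $E^2=E$. Elementary matrices are the invertible matrices corresponding to elementary row operations: matrices differing from the identity in one off-diagonal entry, permutation (row-swap) matrices, and matrices obtained from the identity by replacing a diagonal entry with a unit of $R$ (so invertible diagonal matrices are products of elementary matrices). *)

(* Defs.v *)
From mathcomp Require Import all_boot all_algebra.

Set Implicit Arguments.
Unset Strict Implicit.
Unset Printing Implicit Defensive.

Import GRing.Theory.
Local Open Scope ring_scope.

Definition idempotent_mx (R : pzRingType) (n : nat) (E : 'M[R]_n) : Prop :=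
  E *m E = E.

Inductive elementary_mx (R : comUnitRingType) (n : nat) : 'M[R]_n -> Prop :=
| Elementary_transvection (i j : 'I_n) (a : R) :
    i != j -> elementary_mx (1%:M + a *: delta_mx i j)
| Elementary_swap (i j : 'I_n) :
    elementary_mx (tperm_mx i j)
| Elementary_dilation (i : 'I_n) (u : R) :
    u \is a GRing.unit ->
    elementary_mx (diag_mx (\row_k (if k == i then u else 1))).

Definition product_of (R : pzRingType) (n : nat) (P : 'M[R]_n -> Prop)
    (A : 'M[R]_n) : Prop :=
  exists2 s : seq 'M[R]_n, (forall E, E \in s -> P E) & A = \prod_(E <- s) E.

(* Main.v *)
(** Let [r] be the first row of an invertible matrix [A], so that [r x = 1] for
    some column [x], and factor the singular matrix with rows [r] and [0] into
    idempotents [E_1 ... E_k].  Put [r_i = e_1 E_1 ... E_i], where [e_1] is the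
    row [(1, 0)], and [w_i = E_i ... E_k x].  Since [E_i w_i = w_i], both
    [r_(i-1)] and [r_i] take the value [1] at [w_i].  Two rows taking the
    value [1] at a common column differ by two transvections, in a basis where
    one of them is [e_1].  Hence
    [r = r_k] is the first row of a product of elementary matrices, and
    dividing [A] by this product leaves a lower triangular matrix. *)
Require Import Defs.
From mathcomp Require Import all_boot all_algebra.
From mathcomp Require Import ring.
Import GRing.Theory.
Local Open Scope ring_scope.

Lemma product_of_sing (R : pzRingType) n (P : 'M[R]_n -> Prop) (A : 'M[R]_n) :
  P A -> product_of P A.
Proof.
by move=> PA; exists [:: A]; [move=> E /[!inE]/eqP -> | rewrite big_seq1].
Qed.

Lemma product_of_mul (R : pzRingType) n (P : 'M[R]_n -> Prop)
    (A B : 'M[R]_n) :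
  product_of P A -> product_of P B -> product_of P (A *m B).
Proof.
move=> [s Ps ->] [t Pt ->]; exists (s ++ t); last by rewrite big_cat.
by move=> E; rewrite mem_cat => /orP[/Ps|/Pt].
Qed.

Lemma sum_ord2 (V : nmodType) (F : 'I_2 -> V) : \sum_i F i = F 0 + F 1.
Proof.
by rewrite !big_ord_recl big_ord0 addr0; congr (_ + F _); exact: val_inj.
Qed.

Lemma det_mx22 (R : comPzRingType) (A : 'M[R]_2) :
  \det A = A 0 0 * A 1 1 - A 0 1 * A 1 0.
Proof.
rewrite (expand_det_row _ 0) sum_ord2 /cofactor !det_mx11 !mxE.
rewrite /= expr0 mul1r expr1 mulN1r mulrN.
by congr (A _ _ * A _ _ - A _ _ * A _ _); exact: val_inj.
Qed.

Lemma forall_ord2 (P : 'I_2 -> Prop) : P 0 -> P 1 -> forall i, P i.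
Proof.
by move=> P0 P1 [[|[|//]] i2]; [move: P0 | move: P1]; congr P; exact: val_inj.
Qed.

Section ElementaryRows.

Variable R : comUnitRingType.
Implicit Types (r v : 'rV[R]_2) (w x : 'cV[R]_2) (A E M : 'M[R]_2).

(** Invertibility of [M] is carried along so that [invmx M] cancels without inspecting the
    factors. *)
Definition elementary_row r : Prop :=
  exists M, [/\ M \in unitmx, product_of (@elementary_mx R 2) M & r = row 0 M].

Lemma elementary_row_delta : elementary_row (delta_mx 0 0).
Proof.
exists 1%:M; split; [exact: unitmx1 | by exists nil; rewrite ?big_nil |].
by rewrite row1.
Qed.

Lemma elementary_row_transfer r v w :
  elementary_row r -> r *m w = 1%:M -> v *m w = 1%:M -> elementary_row v.
Proof.
move=> [M [Mu Mel ->]] rw vw.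
(* Coordinates of [v] and [w] in the basis formed by the rows of [M], where [r] becomes [(1, 0)]. *)
pose z := v *m invmx M; pose y := M *m w.
have y0 : y 0 0 = 1.
  by move/matrixP/(_ 0 0): rw; rewrite -row_mul !mxE.
have zy : z 0 0 + z 0 1 * y 1 0 = 1.
  have /matrixP/(_ 0 0) : z *m y = 1%:M by rewrite /z /y mulmxA mulmxKV.
  by rewrite [LHS]mxE [RHS]mxE sum_ord2 y0 mulr1.
have zM : z *m M = v by rewrite /z mulmxKV.
clearbody z y.
pose U : 'M[R]_2 := 1%:M + z 0 1 *: delta_mx 0 1.
pose L : 'M[R]_2 := 1%:M + (- y 1 0) *: delta_mx 1 0.
(* The first row of [U *m L] is [(1 - z 0 1 * y 1 0, z 0 1)], which is [z] by [zy]. *)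
exists (U *m L *m M); split.
- rewrite !unitmx_mul Mu andbT; apply/andP; split;
    by rewrite unitmxE det_mx22 !mxE /= ?(mulr0, mulr1, mul0r, addr0, subr0)
      unitr1.
- apply: product_of_mul Mel; apply: product_of_mul; apply: product_of_sing;
    exact: Elementary_transvection.
rewrite row_mul; suff -> : row 0 (U *m L) = z by [].
apply/rowP; apply: forall_ord2; rewrite mxE mxE sum_ord2 !mxE /=.
  by rewrite -[RHS](addrK (z 0 1 * y 1 0)) zy; ring.
by ring.
Qed.

(** Induction on [s] with [x] fixed and [r] varying: the head factor [E] is absorbed into the row,
    replacing [r] by [r *m E]. *)
Lemma elementary_row_idempotents (s : seq 'M[R]_2) r x :
  (forall E, E \in s -> idempotent_mx E) -> elementary_row r ->
  r *m (\prod_(E <- s) E) *m x = 1%:M ->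
  elementary_row (r *m \prod_(E <- s) E).
Proof.
elim: s r => [|E s IHs] r idem rel; first by rewrite big_nil mulmx1.
rewrite big_cons mulmxA => rx; apply: IHs => //.
  by move=> F Fs; apply: idem; rewrite inE Fs orbT.
pose w := E *m (\prod_(F <- s) F) *m x.
have Ew : E *m w = w by rewrite /w !mulmxA idem ?mem_head.
have rw : r *m w = 1%:M by rewrite /w !mulmxA.
by apply: (elementary_row_transfer _ _ w rel rw); rewrite -mulmxA Ew.
Qed.

Lemma elementary_product_row0_delta A :
  A \in unitmx -> row 0 A = delta_mx 0 0 -> product_of (@elementary_mx R 2) A.
Proof.
move=> Au /rowP A0.
have A00 : A 0 0 = 1 by have := A0 0; rewrite !mxE.
have A01 : A 0 1 = 0 by have := A0 1; rewrite !mxE.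
have A11 : A 1 1 \is a GRing.unit.
  by move: Au; rewrite unitmxE det_mx22 A00 A01 mul1r mul0r subr0.
(* [A] is lower triangular with diagonal [(1, A 1 1)], so one row operation clears [A 1 0]. *)
have -> : A = (1%:M + A 1 0 *: delta_mx 1 0)
              *m diag_mx (\row_k (if k == 1 then A 1 1 else 1)).
  rewrite mul_mx_diag; apply/matrixP; do 2!apply: forall_ord2;
    by rewrite !mxE /= ?A00 ?A01; ring.
by apply: product_of_mul; apply: product_of_sing;
  [apply: Elementary_transvection | apply: Elementary_dilation].
Qed.

End ElementaryRows.

Theorem proposition3p4 (R : idomainType)
  (singular_idempotents : forall A : 'M[R]_2,
     \det A = 0 -> product_of (@idempotent_mx R 2) A) :
  forall A : 'M[R]_2,
    A \in unitmx -> product_of (@elementary_mx R 2) A.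
Proof.
move=> A Au.
pose e : 'rV[R]_2 := delta_mx 0 0.
pose S : 'M[R]_2 := delta_mx 0 0 *m A.
have eS : e *m S = row 0 A by rewrite /S mulmxA mul_delta_mx -rowE.
have [|s idem Ss] := singular_idempotents S.
  by rewrite det_mulmx det_mx22 !mxE /= mulr0 mul0r subrr mul0r.
have : elementary_row R (row 0 A).
  rewrite -eS Ss.
  (* The column [x] is the first column of the inverse of [A]. *)
  apply: (elementary_row_idempotents _ s e (invmx A *m delta_mx 0 0)) => //.
    exact: elementary_row_delta.
  rewrite -Ss eS rowE mulmxA mulmxK // mul_delta_mx.
  by apply/matrixP => i j; rewrite !ord1 !mxE.
move=> [M [Mu Mel AM]].
(* [A] and [M] share their first row, so [A *m invmx M] has first row [(1, 0)]. *)
rewrite -(mulmxKV Mu A); apply: product_of_mul => //.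
apply: elementary_product_row0_delta; first by rewrite unitmx_mul Au unitmx_inv.
by rewrite row_mul AM -row_mul mulmxV // row1.
Qed.
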